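(* For any integers $m\ge3$ and $n\ge2$ with $m\le\frac{n(n+1)}2$, there exist $C\in\mathbb S^n$, a linear map $\mathcal A:\mathbb S^n\to\mathbb R^m$ and $b\in\mathbb R^m$ such that (P) has a unique optimal solution, this solution has rank one, and for any $\epsilon>0$ there exist an optimal solution $y^*$ of (D) and a $y\in\mathbb R^m$ with $\|y-y^*\|_2\le\epsilon$ such that (AL-P) with $\rho=1$ admits a unique solution $X_{y,\rho}$, whose rank $r$ satisfies $r=\max\{l\in\mathbb{N}:\frac{l(l+1)}2\le m\}$.
   Context: $\mathbb S^n$: real symmetric $n\times n$ matrices with the trace inner product. $\mathcal A^*$ is the adjoint of $\mathcal A$. (P): minimize $\langle C,X\rangle$ subject to $\mathcal AX=b$, $X\succeq0$. (D): maximize $\langle b,y\rangle$ subject to $C-\mathcal A^*y\succeq0$. (AL-P), for $\rho>0$ and $y\in\mathbb R^m$: minimize $\langle C,X\rangle+\langle y,b-\mathcal AX\rangle+\frac\rho2\|\mathcal AX-b\|_2^2$ over $X\succeq0$. *)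

(* Defs.v *)
From HB Require Import structures.
From mathcomp Require Import all_boot all_order all_algebra.
From mathcomp Require Import reals.

Set Implicit Arguments.
Unset Strict Implicit.
Unset Printing Implicit Defensive.
Import Order.TTheory GRing.Theory Num.Theory.
Local Open Scope ring_scope.

Section SymmetricMatrices.
Variables (R : realType) (n : nat).

Lemma symmetricmxP (X : 'M[R]_n) : reflect (X^T = X) (X \is symmetricmx).
Proof.
rewrite is_hermitianmxE expr0 scale1r map_mx_id //.
by apply: (iffP eqP).
Qed.

Definition symmx_pred : {pred 'M[R]_n} := fun X => X \is symmetricmx.

Fact symmx_submod_closed : submod_closed symmx_pred.
Proof.
split=> [|a X Y]; first exact/symmetricmxP/trmx0.
move=> /symmetricmxP hX /symmetricmxP hY; apply/symmetricmxP.
by rewrite linearD linearZ /= hX hY.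
Qed.

HB.instance Definition _ :=
  GRing.isSubmodClosed.Build R 'M[R]_n symmx_pred symmx_submod_closed.

(* S^n is a type, rather than a predicate on 'M_n, so that linear maps defined
   on S^n only can be written {linear symmx R n -> _}. *)
Record symmx :=
  SymMx { mx_of_symmx :> 'M[R]_n; _ : mx_of_symmx \in symmx_pred }.

HB.instance Definition _ := [isSub for mx_of_symmx].
HB.instance Definition _ := [Choice of symmx by <:].
HB.instance Definition _ := [SubChoice_isSubLmodule of symmx by <:].

Fact mx_of_symmx_is_linear : linear mx_of_symmx.
Proof. by []. Qed.

HB.instance Definition _ :=
  GRing.isLinear.Build R symmx 'M[R]_n _ mx_of_symmx mx_of_symmx_is_linear.

Lemma trmx_symmx (X : symmx) : (X : 'M[R]_n)^T = X.
Proof. by apply/symmetricmxP; case: X. Qed.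

Lemma symmxE (X : symmx) i j : (X : 'M[R]_n) j i = (X : 'M[R]_n) i j.
Proof. by rewrite -[in LHS]trmx_symmx mxE. Qed.

Definition trdot (X Y : symmx) : R := \tr ((X : 'M[R]_n) *m Y).

Lemma trdotC (X Y : symmx) : trdot X Y = trdot Y X.
Proof. exact: mxtrace_mulC. Qed.

Definition psd (X : symmx) : Prop :=
  forall v : 'cV[R]_n, 0 <= (v^T *m (X : 'M[R]_n) *m v) 0 0.

Definition symmx_basis (i j : 'I_n) : 'M[R]_n :=
  2^-1 *: (delta_mx i j + delta_mx j i).

Fact symmx_basis_sym i j : symmx_basis i j \in symmx_pred.
Proof.
by apply/symmetricmxP; rewrite linearZ linearD /= !trmx_delta addrC.
Qed.

Definition symmx_delta (i j : 'I_n) : symmx := SymMx (symmx_basis_sym i j).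

Lemma trdot_delta (i j : 'I_n) (X : symmx) :
  trdot (symmx_delta i j) X = (X : 'M[R]_n) i j.
Proof.
have E k l : \tr (delta_mx k l *m (X : 'M[R]_n)) = (X : 'M[R]_n) l k.
  rewrite /mxtrace (bigD1 k) //= big1 ?addr0 => [|h /negPf hk]; last first.
    rewrite mxE big1 // => o _.
    by rewrite mxE hk mul0r.
  rewrite mxE (bigD1 l) //= big1 ?addr0 => [|h /negPf hk].
    by rewrite mxE !eqxx mul1r.
  by rewrite mxE hk andbF mul0r.
rewrite /trdot /= /symmx_basis -scalemxAl mulmxDl linearZ linearD /= !E.
rewrite symmxE -mulr2n -[X in _ * X]mulr_natl mulKf ?pnatr_eq0 //.
Qed.

End SymmetricMatrices.

Section Euclidean.
Variables (R : realType) (m : nat).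

Definition dot (u v : 'cV[R]_m) : R := \sum_i u i 0 * v i 0.

(* The library norm on matrices is the max norm. *)
Definition l2norm (u : 'cV[R]_m) : R := Num.sqrt (dot u u).

End Euclidean.

Section Adjoint.
Variables (R : realType) (m n : nat) (A : {linear symmx R n -> 'cV[R]_m}).

(* By [trdot_delta], entry (i, j) of a symmetric matrix is its inner product
   with [symmx_delta i j]; this forces the entries of the adjoint. *)
Definition adj_mx (y : 'cV[R]_m) : 'M[R]_n :=
  \matrix_(i, j) dot (A (symmx_delta R i j)) y.

Fact adj_mx_sym y : adj_mx y \in @symmx_pred R n.
Proof.
apply/symmetricmxP/matrixP => i j; rewrite !mxE; congr (dot (A _) _).
by apply: val_inj; rewrite /= /symmx_basis addrC.
Qed.

Definition adj (y : 'cV[R]_m) : symmx R n := SymMx (adj_mx_sym y).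

Lemma adjP (X : symmx R n) (y : 'cV[R]_m) : trdot X (adj y) = dot (A X) y.
Proof.
have XE : X = \sum_i \sum_j (X : 'M[R]_n) i j *: symmx_delta R i j.
  apply/val_inj/matrixP => k l; rewrite (raddf_sum (@mx_of_symmx R n)) summxE.
  under eq_bigr do rewrite (raddf_sum (@mx_of_symmx R n)) summxE /=.
  rewrite -trdot_delta trdotC /trdot /mxtrace; apply: eq_bigr => i _.
  rewrite mxE; apply: eq_bigr => j _; rewrite !mxE.
  rewrite (eq_sym j k) (eq_sym i l) (eq_sym j l) (eq_sym i k).
  by rewrite addrC [(l == j) && _]andbC.
have dotDl (u v w : 'cV[R]_m) a : dot (a *: u + v) w = a * dot u w + dot v w.
  rewrite /dot mulr_sumr -big_split; apply: eq_bigr => k _ /=.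
  by rewrite !mxE mulrDl mulrA.
have dot0l (w : 'cV[R]_m) : dot 0 w = 0.
  by rewrite /dot big1 // => k _; rewrite mxE mul0r.
have dotZl a (u w : 'cV[R]_m) : dot (a *: u) w = a * dot u w.
  by rewrite -[a *: u]addr0 dotDl dot0l addr0.
have dotsum I (r : seq I) (F : I -> 'cV[R]_m) w :
    dot (\sum_(i <- r) F i) w = \sum_(i <- r) dot (F i) w.
  elim: r => [|h r IH]; first by rewrite !big_nil dot0l.
  by rewrite !big_cons -[F h]scale1r dotDl mul1r IH scale1r.
rewrite [in RHS]XE linear_sum dotsum /trdot /mxtrace; apply: eq_bigr => i _.
rewrite linear_sum dotsum mxE; apply: eq_bigr => j _.
rewrite linearZ /= dotZl mxE; congr (_ * dot (A _) _).
by apply: val_inj; rewrite /= /symmx_basis addrC.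
Qed.

Lemma adj_unique (B : 'cV[R]_m -> symmx R n) :
  (forall X y, trdot X (B y) = dot (A X) y) -> B =1 adj.
Proof.
move=> hB y; apply/val_inj/matrixP => i j /=.
by rewrite -trdot_delta hB mxE.
Qed.

End Adjoint.

Section Programs.
Variables (R : realType) (m n : nat).
Variables (C : symmx R n) (A : {linear symmx R n -> 'cV[R]_m}) (b : 'cV[R]_m).

Definition minimizer (T : Type) (S : T -> Prop) (f : T -> R) (x : T) : Prop :=
  S x /\ forall z, S z -> f x <= f z.

Definition maximizer (T : Type) (S : T -> Prop) (f : T -> R) (x : T) : Prop :=
  S x /\ forall z, S z -> f z <= f x.

Definition P_feasible (X : symmx R n) : Prop := A X = b /\ psd X.

Definition P_optimal : symmx R n -> Prop := minimizer P_feasible (trdot C).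

Definition D_feasible (y : 'cV[R]_m) : Prop := psd (C - adj A y).

Definition D_optimal : 'cV[R]_m -> Prop := maximizer D_feasible (dot b).

Definition AL_objective (rho : R) (y : 'cV[R]_m) (X : symmx R n) : R :=
  trdot C X + dot y (b - A X) + rho / 2 * l2norm (A X - b) ^+ 2.

Definition ALP_optimal (rho : R) (y : 'cV[R]_m) : symmx R n -> Prop :=
  minimizer (@psd R n) (AL_objective rho y).

End Programs.

Definition is_max_nat (S : nat -> Prop) (r : nat) : Prop :=
  S r /\ forall l, S l -> (l <= r)%N.

(* Main.v *)
From HB Require Import structures.
Require Import Defs.
From mathcomp Require Import all_boot all_order all_algebra.
From mathcomp Require Import reals.
From mathcomp Require Import ring lra zify.
Import Order.TTheory GRing.Theory Num.Theory.
Local Open Scope ring_scope.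

Set Implicit Arguments.
Unset Strict Implicit.
Unset Printing Implicit Defensive.

(** Let [r] be the largest integer with [r(r+1)/2 <= m].  Let [A] record the
    entries of the leading [r]x[r] block, which fit into [m] coordinates, let
    [C = diag(0, I)] be the projection on the complementary block, and
    [b = A E11].  Since [<C, X> >= 0] on the psd cone, with equality only if [X]
    is supported on the leading block, [E11] is the unique solution of (P) and
    [y* = 0] solves (D).  Completing the square, the objective of (AL-P) is
    [<C, X> + |A X - b - y|^2 / 2] up to a constant, so for
    [y = t A diag(I_r, 0)] the unique minimizer is [E11 + t diag(I_r, 0)], which
    has rank [r] for every [t > 0]. *)

(** * Rank-one matrices and positive semidefiniteness *)

Section PsdMatrices.
Variables (R : realType) (n : nat).
Implicit Types (X Y : symmx R n) (v : 'cV[R]_n).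

Lemma outer_sym v : v *m v^T \in @symmx_pred R n.
Proof. by apply/symmetricmxP; rewrite trmx_mul trmxK. Qed.

Definition outer v : symmx R n := SymMx (outer_sym v).

Lemma trdot_outer v X : trdot (outer v) X = (v^T *m (X : 'M[R]_n) *m v) 0 0.
Proof.
by rewrite /trdot /= -mulmxA mxtrace_mulC /mxtrace big_ord_recl big_ord0 addr0.
Qed.

Lemma psd_outer v : psd (outer v).
Proof.
move=> u /=; rewrite mulmxA -mulmxA.
have -> : u^T *m v = (v^T *m u)^T by rewrite trmx_mul trmxK.
by rewrite mxE big_ord_recl big_ord0 addr0 mxE -expr2 sqr_ge0.
Qed.

Lemma mx_of_symmxD X Y : (X + Y : symmx R n) = (X : 'M[R]_n) + Y :> 'M[R]_n.
Proof. by []. Qed.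

Lemma mx_of_symmxB X Y : (X - Y : symmx R n) = (X : 'M[R]_n) - Y :> 'M[R]_n.
Proof. by []. Qed.

Lemma mx_of_symmxZ a X : (a *: X : symmx R n) = a *: (X : 'M[R]_n) :> 'M[R]_n.
Proof. by []. Qed.

Lemma psdD X Y : psd X -> psd Y -> psd (X + Y).
Proof.
by move=> pX pY v; rewrite mx_of_symmxD mulmxDr mulmxDl mxE addr_ge0 ?pX ?pY.
Qed.

Lemma psdZ a X : 0 <= a -> psd X -> psd (a *: X).
Proof.
move=> a0 pX v; rewrite mx_of_symmxZ -scalemxAr -scalemxAl mxE.
by rewrite mulr_ge0 ?pX.
Qed.

Lemma trdotDl X Y Z : trdot (X + Y) Z = trdot X Z + trdot Y Z.
Proof. by rewrite /trdot mx_of_symmxD mulmxDl raddfD. Qed.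

Lemma trdotBl X Y Z : trdot (X - Y) Z = trdot X Z - trdot Y Z.
Proof. by rewrite /trdot mx_of_symmxB mulmxBl raddfB. Qed.

Lemma bilin_delta (M : 'M[R]_n) i j :
  ((delta_mx i 0 : 'cV[R]_n)^T *m M *m (delta_mx j 0 : 'cV[R]_n)) 0 0 = M i j.
Proof. by rewrite trmx_delta -rowE -colE !mxE. Qed.

Lemma psd_diag_ge0 X i : psd X -> 0 <= (X : 'M[R]_n) i i.
Proof. by move=> /(_ (delta_mx i 0)); rewrite bilin_delta. Qed.

(** With a zero diagonal entry at [i], the quadratic form at [e_j - s e_i] is affine in [s] with
    slope [-2 X i j], hence unbounded below unless [X i j = 0]. *)
Lemma psd_diag_eq0 X i j :
  psd X -> (X : 'M[R]_n) i i = 0 -> (X : 'M[R]_n) i j = 0.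
Proof.
move=> pX Xi0; apply/eqP; apply: contraT => Xij.
(* The coefficient [s] is chosen so that the form takes the value [-1]. *)
have := pX (delta_mx j 0
  - (((X : 'M[R]_n) j j + 1) / (2 * (X : 'M[R]_n) i j)) *: delta_mx i 0).
set s := _ / _.
rewrite [_^T]linearB [X in _ - X]linearZ /= !mulmxBl !mulmxBr -!scalemxAl -!scalemxAr.
move: (bilin_delta X i i) (bilin_delta X i j).
move: (bilin_delta X j i) (bilin_delta X j j).
set a := (_ *m _ *m _) => ha; set b := (_ *m _ *m _) => hb.
set c := (_ *m _ *m _) => hc; set d := (_ *m _ *m _) => hd.
clearbody a b c d; rewrite !mxE ha hb hc hd Xi0 (symmxE X i j).
have -> : (X : 'M[R]_n) j j - s * (X : 'M[R]_n) i j
   - (s * (X : 'M[R]_n) i j - s * (s * 0)) = -1.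
  by rewrite /s; field.
by rewrite ler0N1.
Qed.

End PsdMatrices.

(** * Euclidean inner product and norm *)

Lemma dotC (R : realType) m (u v : 'cV[R]_m) : dot u v = dot v u.
Proof. by apply: eq_bigr => i _; rewrite mulrC. Qed.

Lemma dotDl (R : realType) m (u v w : 'cV[R]_m) :
  dot (u + v) w = dot u w + dot v w.
Proof. by rewrite /dot -big_split; apply: eq_bigr => i _; rewrite mxE mulrDl. Qed.

Lemma dotNl (R : realType) m (u w : 'cV[R]_m) : dot (- u) w = - dot u w.
Proof. by rewrite /dot -sumrN; apply: eq_bigr => i _; rewrite mxE mulNr. Qed.

Lemma dot_ge0 (R : realType) m (u : 'cV[R]_m) : 0 <= dot u u.
Proof. by apply: sumr_ge0 => i _; rewrite -expr2 sqr_ge0. Qed.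

Lemma dot_eq0 (R : realType) m (u : 'cV[R]_m) : dot u u = 0 -> u = 0.
Proof.
move=> /psumr_eq0P u0; apply/colP => i; rewrite mxE; apply/eqP.
rewrite -[_ == 0]orbb -mulf_eq0 u0 // => k _.
by rewrite -expr2 sqr_ge0.
Qed.

Lemma l2norm_scale (R : realType) m (a : R) (u : 'cV[R]_m) :
  0 <= a -> l2norm (a *: u) = a * l2norm u.
Proof.
move=> a0; rewrite /l2norm.
have -> : dot (a *: u) (a *: u) = a ^+ 2 * dot u u.
  by rewrite /dot mulr_sumr; apply: eq_bigr => i _; rewrite !mxE; ring.
by rewrite sqrtrM ?sqr_ge0 // sqrtr_sqr ger0_norm.
Qed.

(** * Optimality when [A] is injective on the face of the psd cone where [C] vanishes *)

Section ExposedFace.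
Variables (R : realType) (m n : nat).
Variables (C : symmx R n) (A : {linear symmx R n -> 'cV[R]_m}).
Hypothesis C_ge0 : forall X, psd X -> 0 <= trdot C X.
Hypothesis A_inj : forall X Z, psd X -> psd Z ->
  trdot C X = 0 -> trdot C Z = 0 -> A X = A Z -> X = Z.

Lemma P_optimal_unique X0 : psd X0 -> trdot C X0 = 0 ->
  unique (P_optimal C A (A X0)) X0.
Proof.
move=> pX0 CX0; split=> [|Z [[AZ pZ] Zmin]].
  by split=> // Z [_ pZ]; rewrite CX0 C_ge0.
apply: A_inj => //; apply/eqP; rewrite eq_le C_ge0 // andbT -CX0.
exact: Zmin.
Qed.

(** Weak duality: testing the dual slack of any feasible [z] at [v] bounds its dual value by the
    cost of [outer v], which is 0, the value attained at 0. *)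
Lemma D_optimal0 v : trdot C (outer v) = 0 -> D_optimal C A (A (outer v)) 0.
Proof.
have dot0 w : dot w (0 : 'cV[R]_m) = 0.
  by rewrite /dot big1 // => i _; rewrite mxE mulr0.
move=> Cv; split=> [u|z Dz].
  have -> : C - adj A 0 = C.
    apply: val_inj; rewrite [LHS]mx_of_symmxB; apply/matrixP => i j.
    by rewrite !mxE dot0 subr0.
  by rewrite -trdot_outer trdotC C_ge0 //; exact: psd_outer.
rewrite dot0 -adjP trdotC.
have := Dz v; rewrite -trdot_outer trdotC trdotBl Cv.
lra.
Qed.

Lemma AL_objectiveE b y X : AL_objective C A b 1 y X =
  trdot C X + dot (A X - b - y) (A X - b - y) / 2 - dot y y / 2.
Proof.
rewrite /AL_objective sqr_sqrtr ?dot_ge0 // -(opprB (A X) b).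
move: (A X - b) => w.
have dotBB : dot (w - y) (w - y) = dot w w - 2 * dot w y + dot y y.
  rewrite dotDl dotNl [dot w _]dotC [dot y _]dotC !dotDl !dotNl (dotC y w).
  ring.
by rewrite dotBB dotC dotNl; field.
Qed.

(** This multiplier makes the completed square vanish at [X1], so both nonnegative terms are zero
    there. Any other minimizer must also annihilate both, and [A_inj] identifies it with [X1]. *)
Lemma ALP_optimal_unique b X1 : psd X1 -> trdot C X1 = 0 ->
  unique (ALP_optimal C A b 1 (A X1 - b)) X1.
Proof.
move=> pX1 CX1.
have sub0 : dot (0 : 'cV[R]_m) 0 = 0.
  by rewrite /dot big1 // => i _; rewrite mxE mulr0.
split=> [|Z [pZ /(_ _ pX1)]].
  split=> // Z pZ; rewrite !AL_objectiveE subrr sub0 CX1.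
  have := C_ge0 pZ; have := dot_ge0 (A Z - b - (A X1 - b)); lra.
rewrite !AL_objectiveE subrr sub0 CX1.
have := C_ge0 pZ; have := dot_ge0 (A Z - b - (A X1 - b)).
move=> d0 c0 le; apply: A_inj => //; first lra.
apply/esym/(addIr (- b))/eqP; rewrite -subr_eq0; apply/eqP/dot_eq0.
lra.
Qed.

End ExposedFace.

(** * Storing the upper triangle in a vector *)

(** The code numbers the upper triangle column by column: column [j] fills the interval from
    ['C(j.+1, 2)] up to, but excluding, ['C(j.+2, 2)], and these intervals are disjoint. *)
Lemma triangular_code_inj i j k l : (i <= j)%N -> (k <= l)%N ->
  ('C(j.+1, 2) + i = 'C(l.+1, 2) + k)%N -> i = k /\ j = l.
Proof.
have lt a b c d : (a <= b)%N -> (b < d)%N ->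
    ('C(b.+1, 2) + a < 'C(d.+1, 2) + c)%N.
  move=> ab bd; apply: leq_trans (leq_addr _ _).
  apply: (@leq_trans 'C(b.+2, 2)); last exact: leq_bin2l.
  by rewrite [in leqRHS]binS bin1; lia.
move=> ij kl e; case: (ltngtP j l) => [jl|lj|jl]; last by subst; lia.
- by have := lt i j k l ij jl; lia.
- by have := lt k l i j kl lj; lia.
Qed.

Lemma exists_block_measurement (R : realType) m n r :
  ('C(r.+1, 2) <= m)%N ->
  exists A : {linear symmx R n -> 'cV[R]_m}, forall X Z, A X = A Z ->
    forall i j : 'I_n, (i <= j)%N -> (j < r)%N ->
      (X : 'M[R]_n) i j = (Z : 'M[R]_n) i j.
Proof.
move=> rm.
pose code (p : 'I_n * 'I_n) := ('C(p.2.+1, 2) + p.1)%N.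
(* By injectivity of the code each sum has at most one term. Writing it as a sum avoids decoding [k]
   and gives 0 when no entry has code [k]. *)
pose f (X : symmx R n) : 'cV[R]_m := \col_k
  \sum_(p : 'I_n * 'I_n | (p.1 <= p.2)%N && (code p == k)) (X : 'M[R]_n) p.1 p.2.
have f_lin : linear f.
  move=> a X Y; apply/colP => k; rewrite !mxE mulr_sumr -big_split.
  by apply: eq_bigr => p _; rewrite mx_of_symmxD mx_of_symmxZ !mxE.
pose fL : {linear symmx R n -> 'cV[R]_m} :=
  HB.pack f (GRing.isLinear.Build R (symmx R n) 'cV[R]_m _ f f_lin).
exists fL => X Z /colP fXZ i j ij jr.
have km : (code (i, j) < m)%N.
  apply: leq_trans rm; apply: (@leq_trans 'C(j.+2, 2)); last exact: leq_bin2l.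
  by rewrite [in leqRHS]binS bin1 /code /=; lia.
have sumE (Y : symmx R n) : f Y (Ordinal km) 0 = (Y : 'M[R]_n) i j.
  rewrite mxE (bigD1 (i, j)) ?ij ?eqxx //= big1 ?addr0 // => -[k l] /=.
  case/andP=> /andP[kl /eqP /(triangular_code_inj kl ij) [ki lj]].
  by case/eqP; congr pair; apply: val_inj.
by rewrite -!sumE; exact: fXZ.
Qed.

(** * The cost and the identity attached to the leading block *)

Section LeadingBlock.
Variables (R : realType) (n r : nat).

Lemma pid_mx_sym : (pid_mx r : 'M[R]_n) \in @symmx_pred R n.
Proof. by apply/symmetricmxP; rewrite tr_pid_mx. Qed.

Definition block_id : symmx R n := SymMx pid_mx_sym.

Lemma copid_mx_sym : (copid_mx r : 'M[R]_n) \in @symmx_pred R n.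
Proof. by apply/symmetricmxP; rewrite linearB /= trmx1 tr_pid_mx. Qed.

Definition block_cost : symmx R n := SymMx copid_mx_sym.

Lemma trdot_block_cost (X : symmx R n) :
  trdot block_cost X = \sum_(i < n | (r <= i)%N) (X : 'M[R]_n) i i.
Proof.
rewrite /trdot /mxtrace [RHS]big_mkcond /=; apply: eq_bigr => i _.
rewrite mxE (bigD1 i) //= big1 ?addr0 => [|k ki].
  rewrite !mxE !eqxx ltnNge; case: (r <= i)%N => /=; first by rewrite subr0 mul1r.
  by rewrite subrr mul0r.
by rewrite !mxE val_eqE eq_sym (negPf ki) subrr mul0r.
Qed.

Lemma block_cost_ge0 (X : symmx R n) : psd X -> 0 <= trdot block_cost X.
Proof.
by move=> pX; rewrite trdot_block_cost sumr_ge0 // => i _; exact: psd_diag_ge0.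
Qed.

(** The cost sums the nonnegative diagonal entries from [r] on, so each is zero and forces its whole
    row to vanish. *)
Lemma block_cost_eq0 (X : symmx R n) : psd X -> trdot block_cost X = 0 ->
  forall i j : 'I_n, (r <= i)%N -> (X : 'M[R]_n) i j = 0.
Proof.
move=> pX; rewrite trdot_block_cost => /psumr_eq0P X0 i j ri.
by apply: psd_diag_eq0 => //; apply: X0 => // k _; exact: psd_diag_ge0.
Qed.

Lemma psd_block_id : psd block_id.
Proof.
move=> v; rewrite mxE sumr_ge0 // => i _; rewrite mxE (bigD1 i) //= big1.
  by rewrite !mxE eqxx addr0 mulrAC mulr_ge0 // -expr2 sqr_ge0.
by move=> k /negPf ki; rewrite !mxE val_eqE ki mulr0.
Qed.

Lemma trdot_block_cost_id : trdot block_cost block_id = 0.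
Proof.
by rewrite trdot_block_cost big1 // => i ri; rewrite mxE ltnNge ri andbF.
Qed.

Lemma outer_delta (i : 'I_n) :
  outer (delta_mx i 0) = delta_mx i i :> 'M[R]_n.
Proof. by rewrite /= trmx_delta mul_delta_mx. Qed.

Lemma trdot_block_cost_outer (i : 'I_n) : (i < r)%N ->
  trdot block_cost (outer (delta_mx i 0)) = 0.
Proof.
move=> ir; rewrite trdot_block_cost outer_delta big1 // => k rk.
rewrite mxE andbb; case: eqP => // ki; move: ir.
by rewrite -ki ltnNge rk.
Qed.

(** The matrix factors as an invertible diagonal matrix, with entries [t] or [t + 1], times
    [pid_mx r]. *)
Lemma rank_outerD_block_id (i : 'I_n) (t : R) : 0 < t -> (i < r)%N -> (r <= n)%N ->
  \rank (outer (delta_mx i 0) + t *: block_id)%R = r.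
Proof.
move=> t0 ir rn; pose d : 'rV[R]_n := \row_k (t + (k == i)%:R).
have -> : (outer (delta_mx i 0) + t *: block_id : symmx R n)
    = diag_mx d *m pid_mx r :> 'M[R]_n.
  rewrite mx_of_symmxD mx_of_symmxZ /= trmx_delta mul_delta_mx mul_diag_mx.
  apply/matrixP => k l; rewrite !mxE val_eqE mulrDl addrC; congr (_ + _).
  case: (eqVneq k i) => [->|_]; last by rewrite mul0r.
  by rewrite ir andbT mul1r eq_sym.
rewrite eqmxMfull ?rank_pid_mx // row_full_unit unitmxE det_diag unitfE.
apply/prodf_neq0 => k _; rewrite mxE gt_eqF // ltr_pwDl //.
Qed.

End LeadingBlock.

Theorem mainTheorem5 (R : realType) (m n : nat)
    (hm : (3 <= m)%N) (hn : (2 <= n)%N) (hmn : (m <= (n * (n + 1)) %/ 2)%N) :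
  exists (C : symmx R n) (A : {linear symmx R n -> 'cV[R]_m}) (b : 'cV[R]_m),
    (exists Xs : symmx R n,
        unique (P_optimal C A b) Xs /\ \rank (Xs : 'M[R]_n) = 1%N) /\
    (forall eps : R, 0 < eps ->
       exists ys y : 'cV[R]_m,
         [/\ D_optimal C A b ys,
             l2norm (y - ys) <= eps &
             exists X : symmx R n,
               unique (ALP_optimal C A b 1 y) X /\
               is_max_nat (fun l => ((l * (l + 1)) %/ 2 <= m)%N)
                 (\rank (X : 'M[R]_n))]).
Proof.
have triE l : ((l * (l + 1)) %/ 2)%N = 'C(l.+1, 2).
  by rewrite bin2 divn2 addn1 mulnC.
have [r r_max] : exists r, is_max_nat (fun l => ((l * (l + 1)) %/ 2 <= m)%N) r.
  have ex1 : exists l, ((l * (l + 1)) %/ 2 <= m)%N by exists 0%N.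
  have ub l : ((l * (l + 1)) %/ 2 <= m)%N -> (l <= m)%N.
    by rewrite triE binS bin1; lia.
  by case: (ex_maxnP ex1 ub) => r rm r_ub; exists r.
have [] := r_max; rewrite triE => rm r_ub.
have r_gt0 : (0 < r)%N by apply: r_ub; apply: leq_trans hm.
(* Otherwise ['C(r.+1, 2)] would be at least ['C(n.+2, 2)], which exceeds ['C(n.+1, 2)] and hence
   [m]. *)
have rn : (r <= n)%N.
  rewrite leqNgt; apply/negP => nr; move: hmn; rewrite triE leqNgt.
  apply/negP/negPn/(leq_trans _ rm).
  apply: (@leq_trans 'C(n.+2, 2)); last exact: leq_bin2l.
  by rewrite [in leqRHS]binS bin1; lia.
have [A A_block] := exists_block_measurement R n rm.
pose C := block_cost R n r.
have C_ge0 X : psd X -> 0 <= trdot C X by exact: block_cost_ge0.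
(* By symmetry only the upper triangle matters: columns below [r] are read off by [A], and the
   others vanish because both costs are zero. *)
have A_inj X Z : psd X -> psd Z ->
    trdot C X = 0 -> trdot C Z = 0 -> A X = A Z -> X = Z.
  move=> pX pZ CX CZ /A_block XZ; apply/val_inj/matrixP => i j /=.
  wlog ij : i j / (i <= j)%N.
    by move=> H; case/orP: (leq_total i j) => ?; [|rewrite -!(symmxE _ i)]; exact: H.
  case: (ltnP j r) => jr; first exact: XZ.
  rewrite -!(symmxE _ i).
  by rewrite (block_cost_eq0 pX CX) // (block_cost_eq0 pZ CZ).
pose i0 : 'I_n := Ordinal (leq_trans r_gt0 rn).
pose E11 : symmx R n := outer (delta_mx i0 0).
pose J := block_id R n r.
have CE : trdot C E11 = 0 by exact: trdot_block_cost_outer.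
have pE : psd E11 by exact: psd_outer.
exists C, A, (A E11); split.
  exists E11; split; first exact: P_optimal_unique.
  by rewrite outer_delta mxrank_delta.
move=> eps eps0.
have nJ : 0 <= l2norm (A J) by exact: sqrtr_ge0.
(* The shift of the multiplier will be [t *: A J], whose norm is then at most [eps]; adding 1 keeps
   the denominator positive even if [A J = 0]. *)
pose t := eps / (1 + l2norm (A J)).
have t0 : 0 < t by rewrite divr_gt0 // ltr_pwDl.
pose X1 := E11 + t *: J.
(* The same dual solution 0 serves every [eps]; the nearby multiplier is the one that makes [X1] the
   minimizer. *)
exists 0, (A X1 - A E11); split; first exact: D_optimal0.
  rewrite subr0 /X1 linearD addrC addKr linearZ (l2norm_scale _ (ltW t0)).
  by rewrite /t mulrAC ler_pdivrMr ?ltr_pwDl // ler_pM2l // lerDr.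
exists X1; split; last by rewrite rank_outerD_block_id.
apply: ALP_optimal_unique => //.
  by apply: psdD => //; apply: psdZ; [exact: ltW | exact: psd_block_id].
rewrite trdotC trdotDl ![trdot _ C]trdotC CE add0r /trdot mx_of_symmxZ.
rewrite -scalemxAr linearZ /=.
have := trdot_block_cost_id R n r; rewrite /trdot /= => ->.
by rewrite mulr0.
Qed.
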